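(* For each $k,n\in\mathbb{N}$, the $k$-card-minimum strategy $\mathcal{S}_{\min}$ is stochastically optimal for minimizing the number of inversions $I$; that is, for every $(k,n)$ choice strategy $\hat{\mathcal{S}} \neq \mathcal{S}_{\min}$, $$\mathbb{P}^{\mathcal{S}_{\min}}_{n,k}(I\le x)\ge\mathbb{P}^{\hat{\mathcal{S}}}_{n,k}(I\le x)\quad\text{for all } x\in\mathbb{R}.$$
   Context: $\mathbb{N}=\{1,2,\dots\}$ and $[n]=\{1,\dots,n\}$. A $(k,n)$ choice strategy is an $n$-tuple $\mathcal{S}=(f_1,\dots,f_n)$ of functions such that for each $t\in[n]$: the domain of $f_t$ is the set of pairs $((c_1,\dots,c_{t-1}),(c_{t,1},\dots,c_{t,k}))$ with all $c_\tau,c_{t,i}\in[n]$, $c_\tau\ne c_{\tau'}$ for $\tau\neq\tau'$, and $c_{t,i}\ne c_\tau$ for all $1\le i\le k$, $1\le\tau\le t-1$; and $f_t$ always takes a value in $\{c_{t,1},\dots,c_{t,k}\}$. Given such an $\mathcal{S}$, a random permutation $\sigma=(C_1,\dots,C_n)$ of $[n]$ is generated as follows: $D_1=[n]$; for $t=1,\dots,n$, given the past, $C_{t,1},\dots,C_{t,k}$ are i.i.d. uniform on $D_t$, then $C_t=f_t[((C_1,\dots,C_{t-1}),(C_{t,1},\dots,C_{t,k}))]$ and $D_{t+1}=D_t\setminus\{C_t\}$. $\mathbb{P}^{\mathcal{S}}_{n,k}$ denotes the corresponding probability measure. The $k$-card-minimum strategy $\mathcal{S}_{\min}$ is the strategy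 with $f_t[((c_1,\dots,c_{t-1}),(c_{t,1},\dots,c_{t,k}))]=\min\{c_{t,1},\dots,c_{t,k}\}$ for every $t$. $I=I(\sigma)=|\{i<j:\sigma(i)>\sigma(j)\}|$ is the number of inversions of $\sigma$. *)

(* Defs.v *)
From HB Require Import structures.
From mathcomp Require Import all_boot all_order all_algebra all_fingroup.
From mathcomp Require Import reals.

Set Implicit Arguments.
Unset Strict Implicit.
Unset Printing Implicit Defensive.

Import Order.TTheory GRing.Theory Num.Theory.

(* MathComp world.  Cards and times are 0-based: both range over 'I_n.
   At time t exactly t cards have already been chosen. *)

Definition admissible (k n t : nat)
    (h : t.-tuple 'I_n * k.-tuple 'I_n) : bool :=
  uniq h.1 && all (fun c => c \notin h.1) h.2.

Definition history (k n t : nat) : Type :=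
  {h : t.-tuple 'I_n * k.-tuple 'I_n | admissible h}.

Record strategy (k n : nat) : Type := Strategy {
  choice_fun : forall t : 'I_n, history k n t -> 'I_n;
  choice_funP : forall (t : 'I_n) (h : history k n t),
    choice_fun h \in (val h).2
}.

(* Positivity of k makes the set of drawn cards nonempty. *)
Definition min_choice (k n : nat) (hk : 0 < k) (t : 'I_n)
    (h : history k n t) : 'I_n :=
  let c := (val h).2 in
  tnth c [arg min_(i < Ordinal hk) (tnth c i : nat)].

Lemma min_choiceP (k n : nat) (hk : 0 < k) (t : 'I_n) (h : history k n t) :
  min_choice hk h \in (val h).2.
Proof. exact: mem_tnth. Qed.

Definition min_strategy (k n : nat) (hk : 0 < k) : strategy k n :=
  Strategy (@min_choiceP k n hk).

Definition past (n : nat) (s : 'S_n) (t : 'I_n) : t.-tuple 'I_n :=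
  [tuple s (widen_ord (ltnW (ltn_ord t)) i) | i < t].

Definition remaining (n : nat) (s : 'S_n) (t : 'I_n) : {set 'I_n} :=
  [set c | c \notin past s t].

Definition chosen (k n : nat) (S : strategy k n) (s : 'S_n) (t : 'I_n)
    (d : k.-tuple 'I_n) : option 'I_n :=
  omap (@choice_fun k n S t) (insub (past s t, d)).

Definition inversions (n : nat) (s : 'S_n) : nat :=
  #|[set p : 'I_n * 'I_n | (p.1 < p.2) && (s p.2 < s p.1)]|.

Local Open Scope ring_scope.

Definition uniform_mass (R : realType) (T : finType) (D : {set T}) (x : T) : R :=
  (x \in D)%:R / #|D|%:R.

(* Chain rule: the joint mass of the event that the draws are w and the
   resulting permutation is s.  At each time t, given the past, the k draws
   are independent and uniform on the remaining cards, and the card s t is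
   then determined by the strategy. *)
Definition joint_mass (R : realType) (k n : nat) (S : strategy k n)
    (s : 'S_n) (w : {ffun 'I_n -> k.-tuple 'I_n}) : R :=
  \prod_(t < n)
    ((\prod_(i < k) uniform_mass R (remaining s t) (tnth (w t) i))
     * (chosen S s t (w t) == Some (s t))%:R).

Definition prob (R : realType) (k n : nat) (S : strategy k n)
    (A : {set 'S_n}) : R :=
  \sum_(s in A) \sum_(w : {ffun 'I_n -> k.-tuple 'I_n}) joint_mass R S s w.

(* Main.v *)
Require Import Defs.
From HB Require Import structures.
From mathcomp Require Import all_boot all_order all_algebra all_fingroup.
From mathcomp Require Import reals.

Set Implicit Arguments.
Unset Strict Implicit.
Unset Printing Implicit Defensive.

Import Order.TTheory GRing.Theory Num.Theory.
Local Open Scope ring_scope.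

(** The inversion number is a sum over times t of the Lehmer digit of s at t:
the rank, among the cards still in the deck, of the card taken at time t
([inversions_lehmer], [lehmer_remaining]).  The digits are free coordinates on
the symmetric group: each tuple with digit t below n - t comes from exactly
one permutation ([lehmer_inj], [lehmer_surj]), and the first t digits determine
the first t cards.

After integrating out the draws, the probability of a permutation is a product
of one-step kernels ([joint_mass_marginal]).  The kernel of an arbitrary
strategy depends on the whole past, but the kernel of the minimum strategy
depends on the time and on the current digit only ([kernel_min]): whatever k
uniform cards are compared, only their ranks matter.

The proof replaces the decisions of S by minimum decisions one time at a time,
starting from the last.  When the decision at time j is replaced, all later
decisions are already minimum decisions.  Fix every digit except the j-th.
Earlier factors depend on earlier digits, later factors each on their own
digit, so their product is a constant; the only thing that varies is the j-th
kernel, and the event that the inversion number is small says that the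
j-th digit is small.  Fixing the draws at time j as well, the minimum drawn
card has the smallest digit on offer, so if the card chosen by S leads to few
inversions then so does the minimum ([kernel_dominance]).  Summing over
the other digits gives [hybrid_step], and n such steps lead from S to the
minimum strategy. *)

(** * Lehmer digits of a permutation *)

Definition lehmer (n : nat) (s : 'S_n) (t : 'I_n) : nat :=
  #|[set u : 'I_n | (t < u)%N && (s u < s t)%N]|.

Lemma inversions_lehmer (n : nat) (s : 'S_n) :
  inversions s = (\sum_(t < n) lehmer s t)%N.
Proof.
rewrite /inversions -sum1dep_card -(pair_big_dep xpredT
  (fun t u : 'I_n => (t < u)%N && (s u < s t)%N) (fun _ _ => 1%N)) /=.
by apply: eq_bigr => t _; rewrite sum1dep_card.
Qed.

Lemma lehmer_lt (n : nat) (s : 'S_n) (t : 'I_n) : (lehmer s t < n - t)%N.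
Proof.
have -> : (n - t)%N = #|[set u : 'I_n | (t <= u)%N]|.
  by rewrite -sum1dep_card -[LHS]muln1 -sum_nat_const_nat big_geq_mkord.
apply: proper_card; apply/properP; split.
  by apply/subsetP => u; rewrite !inE => /andP[/ltnW].
by exists t; rewrite !inE ?leqnn ?ltnn.
Qed.

Lemma mem_remaining (n : nat) (s : 'S_n) (t u : 'I_n) :
  (s u \in remaining s t) = (t <= u)%N.
Proof.
rewrite inE leqNgt; congr negb; apply/mapP/idP;
  [by case=> i _ /perm_inj -> /= | move=> ltut].
by exists (Ordinal ltut); rewrite ?mem_enum //; congr (s _); apply: val_inj.
Qed.

Lemma uniq_past (n : nat) (s : 'S_n) (t : 'I_n) : uniq (past s t).
Proof.
rewrite map_inj_uniq ?enum_uniq // => i j /perm_inj /(congr1 val) /= ij.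
exact: val_inj.
Qed.

Lemma card_remaining (n : nat) (s : 'S_n) (t : 'I_n) :
  #|remaining s t| = (n - t)%N.
Proof.
have := cardC (mem (past s t)).
rewrite (card_uniqP (uniq_past s t)) size_tuple card_ord cardsE => eq_n.
by apply/esym/eqP; rewrite -[X in (X - t)%N == _]eq_n addKn.
Qed.

Lemma lehmer_remaining (n : nat) (s : 'S_n) (t : 'I_n) :
  lehmer s t = #|[set c in remaining s t | (c < s t)%N]|.
Proof.
rewrite /lehmer -[LHS](card_imset _ (@perm_inj _ s)); congr #|pred_of_set _|.
apply/setP => c; rewrite -[c](permKV s) mem_imset; last exact: perm_inj.
rewrite [LHS]in_set [RHS]in_set mem_remaining; set u := s^-1%g c.
by case: (ltngtP t u) => // /val_inj ->; rewrite ltnn.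
Qed.

(** Together with [lehmer_remaining], this recovers the card taken from its
digit and the deck. *)
Lemma rank_inj (n : nat) (D : {set 'I_n}) :
  {in D &, injective (fun c : 'I_n => #|[set d in D | (d < c)%N]|)}.
Proof.
have lt_rank (a b : 'I_n) : a \in D -> (a < b)%N ->
    (#|[set d in D | (d < a)%N]| < #|[set d in D | (d < b)%N]|)%N.
  move=> aD ab; apply: proper_card; apply/properP; split.
    by apply/subsetP => d; rewrite !inE => /andP[-> /ltn_trans ->].
  by exists a; rewrite !inE aD ?ltnn.
move=> a b aD bD /= eq_rank; apply: val_inj.
case: (ltngtP a b) => // [/(lt_rank _ _ aD)|/(lt_rank _ _ bD)];
  by rewrite eq_rank ltnn.
Qed.

Lemma eq_past (n : nat) (s s' : 'S_n) (t : 'I_n) :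
  (forall u : 'I_n, (u < t)%N -> s u = s' u) -> past s t = past s' t.
Proof. by move=> eq_s; apply/eq_from_tnth => i; rewrite !tnth_mktuple eq_s //=. Qed.

Lemma eq_remaining (n : nat) (s s' : 'S_n) (t : 'I_n) :
  past s t = past s' t -> remaining s t = remaining s' t.
Proof. by rewrite /remaining => ->. Qed.

Lemma lehmer_step (n : nat) (s s' : 'S_n) (t : 'I_n) :
  past s t = past s' t -> lehmer s t = lehmer s' t -> s t = s' t.
Proof.
move=> eq_p; rewrite !lehmer_remaining (eq_remaining eq_p); apply: rank_inj.
  by rewrite -(eq_remaining eq_p) mem_remaining.
by rewrite mem_remaining.
Qed.

Lemma lehmer_prefix (n : nat) (s s' : 'S_n) (t : 'I_n) :
  (forall u : 'I_n, (u < t)%N -> lehmer s u = lehmer s' u) ->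
  forall u : 'I_n, (u < t)%N -> s u = s' u.
Proof.
move=> eq_l u; have [m] := ubnP u; elim: m u => // m IHm u /ltnSE le_um ltut.
apply: lehmer_step (eq_l u ltut); apply: eq_past => v ltvu.
exact: IHm (leq_trans ltvu le_um) (ltn_trans ltvu ltut).
Qed.

Lemma lehmer_inj (n : nat) (s s' : 'S_n) : lehmer s =1 lehmer s' -> s = s'.
Proof.
move=> eq_l; apply/permP => t; apply: lehmer_step (eq_l t); apply: eq_past.
by apply: lehmer_prefix => u _; apply: eq_l.
Qed.

(** The digit map is injective into a product of sets of sizes n, n-1, .., 1,
which has as many elements as there are permutations; hence it is onto. *)
Lemma lehmer_surj (n : nat) (f : 'I_n -> nat) :
  (forall t : 'I_n, (f t < n - t)%N) -> exists s : 'S_n, lehmer s =1 f.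
Proof.
move=> lt_f.
pose code (s : 'S_n) : {dffun forall t : 'I_n, 'I_(n - t)} :=
  [ffun t => Ordinal (lehmer_lt s t)].
have code_inj : injective code.
  move=> s s' /ffunP eq_code; apply: lehmer_inj => t.
  by have := congr1 val (eq_code t); rewrite !ffunE.
have le_card : (#|{dffun forall t : 'I_n, 'I_(n - t)}| <= #|'S_n|)%N.
  rewrite card_Sn card_dep_ffun foldrE big_image /=.
  rewrite (eq_bigr (fun t : 'I_n => n - t)%N) => [|t _]; last exact: card_ord.
  by rewrite -ffact_prod ffactnn.
have /codomP[s def_s] := inj_card_onto code_inj le_card
  [ffun t => Ordinal (lt_f t)].
exists s => t; have /ffunP/(_ t)/(congr1 val) := def_s.
by rewrite !ffunE.
Qed.

(** * One-step kernels *)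

Lemma sum_tuple_prod (R : comPzSemiRingType) (T : finType) (k : nat) (g : T -> R) :
  \sum_(d : k.-tuple T) \prod_(i < k) g (tnth d i) = (\sum_x g x) ^+ k.
Proof.
rewrite -[in RHS](card_ord k) -prodr_const bigA_distr_bigA /=.
rewrite (reindex (@tuple_of_finfun T k)) /=; last first.
  by exists finfun_of_tuple => d _; rewrite (finfun_of_tupleK, tuple_of_finfunK).
by apply: eq_bigr => d _; apply: eq_bigr => i _; rewrite tnth_mktuple.
Qed.

Definition draw_mass (R : realType) (k : nat) (T : finType) (D : {set T})
    (d : k.-tuple T) : R :=
  \prod_(i < k) uniform_mass R D (tnth d i).

(** The conditional probability, given the cards taken before time t, that the
card taken at time t is s t. *)
Definition kernel (R : realType) (k n : nat) (S : strategy k n) (s : 'S_n)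
    (t : 'I_n) : R :=
  \sum_(d : k.-tuple 'I_n)
    draw_mass R (remaining s t) d * (chosen S s t d == Some (s t))%:R.

(** The draws at different times enter different factors, so the sum over all
draws distributes over the product. *)
Lemma joint_mass_marginal (R : realType) (k n : nat) (S : strategy k n)
    (s : 'S_n) :
  \sum_(w : {ffun 'I_n -> k.-tuple 'I_n}) joint_mass R S s w =
  \prod_(t < n) kernel R S s t.
Proof. by rewrite bigA_distr_bigA. Qed.

Lemma draw_mass_ge0 (R : realType) (k : nat) (T : finType) (D : {set T})
    (d : k.-tuple T) : 0 <= draw_mass R D d.
Proof. by apply: prodr_ge0 => i _; rewrite divr_ge0 ?ler0n. Qed.

Lemma draw_mass_out (R : realType) (k : nat) (T : finType) (D : {set T})
    (d : k.-tuple T) : ~~ all (mem D) d -> draw_mass R D d = 0.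
Proof.
case/allPn => x /tnthP[i ->] /= diD.
by rewrite /draw_mass (bigD1 i) //= /uniform_mass (negPf diD) !mul0r.
Qed.

Lemma kernel_ge0 (R : realType) (k n : nat) (S : strategy k n) (s : 'S_n)
    (t : 'I_n) : 0 <= kernel R S s t.
Proof. by apply: sumr_ge0 => d _; rewrite mulr_ge0 ?draw_mass_ge0. Qed.

Lemma eq_chosen (k n : nat) (S : strategy k n) (s s' : 'S_n) (t : 'I_n) :
  past s t = past s' t -> chosen S s t =1 chosen S s' t.
Proof. by rewrite /chosen => -> d. Qed.

Lemma eq_kernel (R : realType) (k n : nat) (S : strategy k n) (s s' : 'S_n)
    (t : 'I_n) :
  past s t = past s' t -> s t = s' t -> kernel R S s t = kernel R S s' t.
Proof.
move=> eq_p eq_t; rewrite /kernel (eq_remaining eq_p) eq_t.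
by apply: eq_bigr => d _; rewrite (eq_chosen S eq_p).
Qed.

Lemma admissible_past (k n : nat) (s : 'S_n) (t : 'I_n) (d : k.-tuple 'I_n) :
  all (mem (remaining s t)) d -> admissible (past s t, d).
Proof.
move=> dD; rewrite /admissible uniq_past /=; apply: sub_all dD => c /=.
by rewrite inE.
Qed.

Lemma chosen_mem (k n : nat) (S : strategy k n) (s : 'S_n) (t : 'I_n)
    (d : k.-tuple 'I_n) :
  all (mem (remaining s t)) d -> exists2 c, c \in d & chosen S s t d = Some c.
Proof.
move=> /admissible_past adm; rewrite /chosen (insubT _ adm) /=.
exists (choice_fun S (Sub (past s t, d) adm : history k n t)); last by [].
exact: (choice_funP S (Sub (past s t, d) adm)).
Qed.

Lemma min_choice_le (k n : nat) (hk : (0 < k)%N) (t : 'I_n)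
    (h : history k n t) (c : 'I_n) :
  c \in (val h).2 -> (min_choice hk h <= c)%N.
Proof.
case/tnthP=> i ->; rewrite /min_choice.
by case: arg_minnP => // j _; apply.
Qed.

Lemma chosen_min (k n : nat) (hk : (0 < k)%N) (s : 'S_n) (t : 'I_n)
    (d : k.-tuple 'I_n) :
  all (mem (remaining s t)) d ->
  exists c, [/\ c \in d, forall c', c' \in d -> (c <= c')%N
              & chosen (min_strategy n hk) s t d = Some c].
Proof.
move=> /admissible_past adm; rewrite /chosen (insubT _ adm) /=.
pose h : history k n t := Sub (past s t, d) adm.
exists (min_choice hk h); split; last by [].
- exact: (min_choiceP hk h).
by move=> c' c'd; apply: (@min_choice_le k n hk t h).
Qed.

(** The minimum of the draws is c exactly when all draws are at least c but not
all exceed c.  With m = n - t cards left and r of them below c, these events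
have probability ((m - r) / m)^k and ((m - r - 1) / m)^k.  What matters later
is that the value involves s only through its digit at t. *)
Lemma kernel_min (R : realType) (k n : nat) (hk : (0 < k)%N) (s : 'S_n)
    (t : 'I_n) :
  kernel R (min_strategy n hk) s t =
    ((n - t - lehmer s t)%:R / (n - t)%:R) ^+ k
    - ((n - t - lehmer s t).-1%:R / (n - t)%:R) ^+ k.
Proof.
set D := remaining s t; set c := s t.
have cD : c \in D by rewrite mem_remaining.
pose ge_c := [set x in D | (c <= x)%N]; pose gt_c := ge_c :\ c.
have card_ge : #|ge_c| = (n - t - lehmer s t)%N.
  rewrite lehmer_remaining -(card_remaining s t) -/D -/c.
  rewrite -(cardsID [set x : 'I_n | (x < c)%N] D) setIdE addKn setDE.
  by congr #|pred_of_set _|; apply/setP => x; rewrite !inE -leqNgt.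
have card_gt : #|gt_c| = (n - t - lehmer s t).-1.
  have c_ge : c \in ge_c by rewrite in_set cD leqnn.
  by rewrite -card_ge (cardsD1 c ge_c) c_ge.
have mass_all (E : {set 'I_n}) : E \subset D ->
    \sum_(d : k.-tuple 'I_n) draw_mass R D d * (all (mem E) d)%:R =
    (#|E|%:R / (n - t)%:R) ^+ k.
  move=> sED; rewrite -(card_remaining s t) -/D.
  have -> : #|E|%:R / #|D|%:R = \sum_x uniform_mass R D x * (x \in E)%:R.
    rewrite -[#|E|]sum1_card natr_sum mulr_suml big_mkcond.
    apply: eq_bigr => x _; rewrite /uniform_mass.
    case: (boolP (x \in E)) => [/(subsetP sED) -> | _]; last by rewrite mulr0.
    by rewrite mulr1.
  rewrite -sum_tuple_prod; apply: eq_bigr => d _.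
  rewrite big_split; congr (_ * _).
  have [/allP dE | /allPn[x /tnthP[i ->] /= xE]] := boolP (all (mem E) d).
    by rewrite big1 // => i _; rewrite [_ \in _]dE ?mem_tnth.
  by rewrite (bigD1 i) //= (negPf xE) mul0r.
rewrite -card_gt -card_ge -!mass_all; last 2 first.
- by apply/subsetP => x /setD1P[_ /setIdP[]].
- by apply/subsetP => x /setIdP[].
rewrite -sumrB; apply: eq_bigr => d _; rewrite -mulrBr.
have [dD | dD] := boolP (all (mem D) d); last by rewrite draw_mass_out ?mul0r.
congr (_ * _); have [m [md m_min ->]] := chosen_min hk dD.
have -> : all (mem ge_c) d = (c <= m)%N.
  apply/allP/idP => [/(_ m md) /setIdP[] // | cm x xd /=].
  by rewrite inE (leq_trans cm (m_min x xd)) andbT; apply: (allP dD).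
have -> : all (mem gt_c) d = (c < m)%N.
  apply/allP/idP => [/(_ m md) | cm x xd /=].
    by rewrite !inE ltn_neqAle eq_sym => /and3P[-> _ ->].
  have /= cx := leq_trans cm (m_min x xd).
  by rewrite 2!in_set in_set1 [_ \in _](allP dD x xd) (ltnW cx)
    -(inj_eq val_inj) gtn_eqF.
rewrite (inj_eq Some_inj) -(inj_eq val_inj) /=.
by case: ltngtP; rewrite ?subrr ?subr0.
Qed.

(** * Varying a single digit *)

Definition agree_off (n : nat) (j : 'I_n) (s s' : 'S_n) : bool :=
  [forall (t | t != j), lehmer s t == lehmer s' t].

Lemma agree_offP (n : nat) (j : 'I_n) (s s' : 'S_n) :
  reflect (forall t, t != j -> lehmer s t = lehmer s' t) (agree_off j s s').
Proof. exact: 'forall_in_eqP. Qed.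

Lemma agree_off_prefix (n : nat) (j : 'I_n) (s s' : 'S_n) :
  agree_off j s s' -> forall t : 'I_n, (t < j)%N -> s t = s' t.
Proof.
move=> /agree_offP eq_l; apply: lehmer_prefix => u ltuj; apply: eq_l.
by rewrite -(inj_eq val_inj) ltn_eqF.
Qed.

Lemma agree_off_past (n : nat) (j : 'I_n) (s s' : 'S_n) :
  agree_off j s s' -> forall t : 'I_n, (t <= j)%N -> past s t = past s' t.
Proof.
move=> agr t letj; apply: eq_past => u ltut.
exact: agree_off_prefix agr u (leq_trans ltut letj).
Qed.

Lemma agree_off_inj (n : nat) (j : 'I_n) (s s1 s2 : 'S_n) :
  agree_off j s1 s -> agree_off j s2 s -> s1 j = s2 j -> s1 = s2.
Proof.
move=> agr1 agr2 eq_j; apply: lehmer_inj => t.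
have [-> | ntj] := eqVneq t j; last first.
  by rewrite (agree_offP _ _ _ agr1) // (agree_offP _ _ _ agr2).
rewrite !lehmer_remaining eq_j (@eq_remaining _ s1 s2) //.
by rewrite (agree_off_past agr1) // (agree_off_past agr2).
Qed.

(** Changing the j-th digit alone makes any card of the deck the j-th card.  This
is where the freedom of the digits is used. *)
Lemma agree_off_reach (n : nat) (j : 'I_n) (s : 'S_n) (c : 'I_n) :
  c \in remaining s j -> exists2 s', agree_off j s' s & s' j = c.
Proof.
move=> cD; pose r := #|[set d in remaining s j | (d < c)%N]|.
have lt_r : (r < n - j)%N.
  rewrite -(card_remaining s j); apply: proper_card; apply/properP; split.
    by apply/subsetP => d /setIdP[].
  by exists c; rewrite // inE ltnn andbF.
have [|s' def_s'] := @lehmer_surj n (fun t => if t == j then r else lehmer s t).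
  by move=> t; case: eqP => [-> | _] //; apply: lehmer_lt.
have agr : agree_off j s' s.
  by apply/agree_offP => t /negPf ntj; rewrite def_s' ntj.
have eqD := eq_remaining (agree_off_past agr (leqnn j)).
exists s' => //; apply: (@rank_inj _ (remaining s j)) => //.
  by rewrite -eqD mem_remaining.
by have := def_s' j; rewrite eqxx lehmer_remaining eqD.
Qed.

(** Both the inversion number and the j-th card increase with the j-th digit
when the other digits are fixed. *)
Lemma agree_off_inversions (n : nat) (j : 'I_n) (s s1 s2 : 'S_n) :
  agree_off j s1 s -> agree_off j s2 s -> (s1 j <= s2 j)%N ->
  (inversions s1 <= inversions s2)%N.
Proof.
move=> agr1 agr2 le_j; rewrite !inversions_lehmer.
rewrite (bigD1 j) //= [leqRHS](bigD1 j) //=.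
rewrite (eq_bigr (lehmer s2)) => [|t ntj]; last first.
  by rewrite (agree_offP _ _ _ agr1) // (agree_offP _ _ _ agr2).
rewrite leq_add2r !lehmer_remaining (@eq_remaining _ s1 s2); last first.
  by rewrite (agree_off_past agr1) // (agree_off_past agr2).
apply: subset_leq_card; apply/subsetP => d /setIdP[dD lt_d].
by rewrite inE dD (leq_trans lt_d).
Qed.

(** Once the draws d at time j are fixed, at most one permutation in the class
takes the card that S chooses from d, and exactly one takes the minimum of d.
The latter has no more inversions than the former, so a downward closed event
containing the former contains the latter. *)
Lemma kernel_dominance (R : realType) (k n : nat) (hk : (0 < k)%N)
    (S : strategy k n) (A : pred nat) (j : 'I_n) (s : 'S_n) :
  (forall a b : nat, (a <= b)%N -> A b -> A a) ->
  \sum_(s' | A (inversions s') && agree_off j s' s) kernel R S s' j <=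
  \sum_(s' | A (inversions s') && agree_off j s' s)
    kernel R (min_strategy n hk) s' j.
Proof.
move=> A_down.
(* Condition on the draws: the deck and the chosen card are common to the class. *)
have swap (T : strategy k n) :
    \sum_(s' | A (inversions s') && agree_off j s' s) kernel R T s' j =
    \sum_d draw_mass R (remaining s j) d *
      \sum_(s' | A (inversions s') && agree_off j s' s)
         (chosen T s j d == Some (s' j))%:R.
  rewrite exchange_big /=; apply: eq_bigr => d _; rewrite mulr_sumr.
  apply: eq_bigr => s' /andP[_ agr].
  have eq_p := agree_off_past agr (leqnn j).
  by rewrite (eq_remaining eq_p) (eq_chosen T eq_p).
rewrite !swap; apply: ler_sum => d _.
have [dD | /draw_mass_out->] := boolP (all (mem (remaining s j)) d); last first.
  by rewrite !mul0r.
apply: ler_wpM2l; first exact: draw_mass_ge0.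
have [c cd ->] := chosen_mem S dD.
have [m [md m_min ->]] := chosen_min hk dD.
(* If S leads from d to no permutation of the event, the left side is zero. *)
have [s1 /andP[/andP[A1 agr1] /eqP c1] | none] :=
    pickP [pred s' | A (inversions s') && agree_off j s' s & s' j == c];
  last first.
  rewrite big1 => [|s' Ps']; first by apply: sumr_ge0 => s' _; apply: ler0n.
  case: eqP => // -[c_eq]; have := none s'.
  by rewrite /= Ps' c_eq eqxx.
have [s2 agr2 m2] := agree_off_reach (allP dD m md).
have A2 : A (inversions s2).
  apply: A_down A1; apply: agree_off_inversions agr2 agr1 _.
  by rewrite m2 c1 m_min.
rewrite (bigD1 s1) ?A1 //= c1 eqxx big1 ?addr0 => [|s' /andP[/andP[_ agr'] ns']].
  rewrite (bigD1 s2) ?A2 //= m2 eqxx lerDl.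
  by apply: sumr_ge0 => s' _; apply: ler0n.
case: eqP => // -[c_eq]; case/eqP: ns'; apply: agree_off_inj agr' agr1 _.
by rewrite c1.
Qed.

(** * Replacing decisions by minimum decisions *)

(** The probability of s under the strategy that follows S before time m and
the minimum strategy from time m on. *)
Definition hybrid_mass (R : realType) (k n : nat) (hk : (0 < k)%N)
    (S : strategy k n) (m : nat) (s : 'S_n) : R :=
  \prod_(t < n)
    if (t < m)%N then kernel R S s t else kernel R (min_strategy n hk) s t.

(** On a class of permutations with prescribed digits off j, the product [rest]
of the factors at times other than j is constant: the factors before j see only
the first j cards, and the factors after j are minimum kernels.  So the claim
reduces to [kernel_dominance] on each class. *)
Lemma hybrid_step (R : realType) (k n : nat) (hk : (0 < k)%N)
    (S : strategy k n) (A : pred nat) (j : 'I_n) :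
  (forall a b : nat, (a <= b)%N -> A b -> A a) ->
  \sum_(s | A (inversions s)) hybrid_mass R hk S j.+1 s <=
  \sum_(s | A (inversions s)) hybrid_mass R hk S j s.
Proof.
move=> A_down; pose rest s := \prod_(t < n | t != j)
  if (t < j)%N then kernel R S s t else kernel R (min_strategy n hk) s t.
have hybridS s : hybrid_mass R hk S j.+1 s = rest s * kernel R S s j.
  rewrite /hybrid_mass (bigD1 j) //= ltnSn mulrC; congr (_ * _).
  by apply: eq_bigr => t ntj; rewrite ltnS leq_eqVlt (inj_eq val_inj) (negPf ntj).
have hybrid0 s :
    hybrid_mass R hk S j s = rest s * kernel R (min_strategy n hk) s j.
  by rewrite /hybrid_mass (bigD1 j) //= ltnn mulrC.
have eq_rest s s' : agree_off j s s' -> rest s = rest s'.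
  move=> agr; apply: eq_bigr => t ntj; have [lttj | lejt] := ltnP t j.
    apply: eq_kernel; first exact: agree_off_past agr t (ltnW lttj).
    exact: agree_off_prefix agr t lttj.
  by rewrite !kernel_min (agree_offP _ _ _ agr).
(* The key labels the classes of agree_off j; the value at j is a dummy. *)
pose key (s : 'S_n) : {ffun 'I_n -> 'I_n.+1} :=
  [ffun t => if t == j then ord0 else inord (lehmer s t)].
have lt_n (s : 'S_n) t : (lehmer s t < n.+1)%N.
  by rewrite ltnS (leq_trans (ltnW (lehmer_lt s t))) ?leq_subr.
have keyE s s' : (key s == key s') = agree_off j s s'.
  apply/eqP/agree_offP => [/ffunP eq_key t /negPf ntj | eq_l].
    by have := congr1 val (eq_key t); rewrite !ffunE ntj /= !inordK.
  by apply/ffunP => t; rewrite !ffunE; case: eqVneq => // /eq_l->.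
rewrite (partition_big key xpredT) //= [leRHS](partition_big key xpredT) //=.
apply: ler_sum => f _.
have [s /eqP <- | none] := pickP (fun s => key s == f); last first.
  by rewrite !big1 // => s; rewrite none andbF.
under eq_bigl do rewrite keyE; under [leRHS]eq_bigl do rewrite keyE.
rewrite (eq_bigr (fun s' => rest s * kernel R S s' j)); last first.
  by move=> s' /andP[_ /eq_rest <-].
rewrite [leRHS](eq_bigr (fun s' =>
  rest s * kernel R (min_strategy n hk) s' j)); last first.
  by move=> s' /andP[_ /eq_rest <-].
rewrite -!mulr_sumr; apply: ler_wpM2l; last exact: kernel_dominance.
by apply: prodr_ge0 => t _; case: ifP => _; apply: kernel_ge0.
Qed.

Theorem proposition4 (R : realType) (k n : nat) (hk : (0 < k)%N) (hn : (0 < n)%N)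
    (S : strategy k n) (hS : S <> min_strategy n hk) (x : R) :
  prob R S [set s : 'S_n | (inversions s)%:R <= x]
    <= prob R (min_strategy n hk) [set s : 'S_n | (inversions s)%:R <= x].
Proof.
pose A (i : nat) := i%:R <= x.
have A_down (a b : nat) : (a <= b)%N -> A b -> A a.
  by rewrite -(ler_nat R); apply: le_trans.
pose P m := \sum_(s | A (inversions s)) hybrid_mass R hk S m s.
have P_le m : (m <= n)%N -> P m <= P 0%N.
  elim: m => // m IHm lt_mn; apply: le_trans (IHm (ltnW lt_mn)).
  exact: (hybrid_step R hk S (Ordinal lt_mn) A_down).
have -> : prob R S [set s : 'S_n | (inversions s)%:R <= x] = P n.
  rewrite /prob; apply: eq_big => [s | s _]; first by rewrite inE.
  by rewrite joint_mass_marginal; apply: eq_bigr => t _; rewrite ltn_ord.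
suff -> : prob R (min_strategy n hk) [set s : 'S_n | (inversions s)%:R <= x]
    = P 0%N by exact: P_le.
rewrite /prob; apply: eq_big => [s | s _]; first by rewrite inE.
by rewrite joint_mass_marginal.
Qed.
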